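(* Let $M$ be a differentiable $d$-submanifold of $\mathbb{R}^n$. Then there exists an open subset $\nu(M)$ of $\mathbb{R}^n$ such that $M \subseteq \nu(M) \subseteq \Delta_* NM$. In particular, $\operatorname{int}(\Delta_* NM) \neq \varnothing$.
   Context: A topological $d$-submanifold of $\mathbb{R}^n$ is a topological subspace $M\subseteq\mathbb{R}^n$ that is a topological $d$-manifold in the induced topology; all manifolds are assumed connected. $M$ is called a differentiable submanifold iff for every $p\in M$, in a neighbourhood of $p$ the set $M$ coincides (up to a rigid motion of $\mathbb{R}^n$) with the graph $\{(x,f(x))\}$ of a (once, everywhere) differentiable map $f$ from an open subset of $\mathbb{R}^d$ to $\mathbb{R}^{n-d}$; the derivative need not be continuous. The tangent space $T_pM$ is the image of the differential at the point of the parametrization $x\mapsto(x,f(x))$, and the normal space $N_pM$ is the orthogonal complement of $T_pM$ in $\mathbb{R}^n$. Put $NM=\{(p,u)\in\mathbb{R}^n\times\mathbb{R}^n : p\in M,\ u\in N_pM\}$. The codiagonal map is $\Delta_*:\mathbb{R}^n\times\mathbb{R}^n\to\mathbb{R}^n$, $(x,y)\mapsto x+y$, so $\Delta_*NM=\bigcup_{p\in M}(p+N_pM)$. $\operatorname{int}$ denotes interior in $\mathbb{R}^n$. *)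

(* Defs.v *)
From HB Require Import structures.
From mathcomp Require Import all_boot all_order all_algebra.
From mathcomp Require Import all_classical all_reals all_analysis.

Set Implicit Arguments.
Unset Strict Implicit.
Unset Printing Implicit Defensive.

Import Order.TTheory GRing.Theory Num.Theory.
Import numFieldNormedType.Exports.

Local Open Scope classical_set_scope.
Local Open Scope ring_scope.

(* R^n is 'rV[R]_n.  Its library norm is the sup norm, which induces the usual
   topology and the usual notion of differentiability; the Euclidean structure
   enters only through [edot]. *)
Definition edot (R : realType) (n : nat) (u v : 'rV[R]_n) : R :=
  \sum_(i < n) u 0 i * v 0 i.

Definition homeomorphic_sets (S T : topologicalType)
    (A : set S) (B : set T) : Prop :=
  exists (f : S -> T) (g : T -> S),
    [/\ set_fun A B f, set_fun B A g,
        (forall x, A x -> g (f x) = x), (forall y, B y -> f (g y) = y) &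
        {within A, continuous f} /\ {within B, continuous g}].

(* Connected manifolds are taken to be nonempty; the library's [connected]
   holds of the empty set. *)
Definition topological_manifold (R : realType) (d : nat)
    (T : topologicalType) : Prop :=
  [/\ [set: T] !=set0, connected [set: T], hausdorff_space T,
      @second_countable T &
      forall p : T, exists (V : set T) (U : set 'rV[R]_d),
        [/\ open_nbhs p V, open U & homeomorphic_sets V U]].

(* The coercion of [M] to a type is [set_type M], whose canonical topology is
   the one induced from R^n. *)
Definition topological_submanifold (R : realType) (d n : nat)
    (M : set 'rV[R]_n) : Prop :=
  topological_manifold R d M.

Definition rigid_motion (R : realType) (n : nat)
    (g : 'rV[R]_n -> 'rV[R]_n) : Prop :=
  exists (Q : 'M[R]_n) (a : 'rV[R]_n),
    Q *m Q^T = 1%:M /\ (forall x, g x = x *m Q + a).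

(* x |-> (x, f x), with R^d x R^(n-d) identified with R^n. *)
Definition graph_param (R : realType) (d n : nat) (hdn : (d <= n)%N)
    (f : 'rV[R]_d -> 'rV[R]_(n - d)) (x : 'rV[R]_d) : 'rV[R]_n :=
  castmx (erefl 1%N, subnKC hdn) (row_mx x (f x)).

(* Only the values of [f] on the open set [U] matter. *)
Definition local_graph (R : realType) (d n : nat) (hdn : (d <= n)%N)
    (M : set 'rV[R]_n) (p : 'rV[R]_n) (g : 'rV[R]_n -> 'rV[R]_n)
    (U : set 'rV[R]_d) (f : 'rV[R]_d -> 'rV[R]_(n - d)) : Prop :=
  [/\ rigid_motion g, open U, (forall x, U x -> differentiable f x) &
      exists2 V : set 'rV[R]_n, open_nbhs p V &
        M `&` V = [set g (graph_param hdn f x) | x in U]].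

Definition differentiable_submanifold (R : realType) (d n : nat)
    (hdn : (d <= n)%N) (M : set 'rV[R]_n) : Prop :=
  topological_submanifold d M /\
  forall p, M p -> exists g U f, @local_graph R d n hdn M p g U f.

(* For p in a differentiable submanifold M, the image of the differential at
   the point over p is the same for all local graph representations, so the
   union over all of them is just that common image. *)
Definition tangent_space (R : realType) (d n : nat) (hdn : (d <= n)%N)
    (M : set 'rV[R]_n) (p : 'rV[R]_n) : set 'rV[R]_n :=
  [set w | exists g U f x,
    [/\ @local_graph R d n hdn M p g U f, U x,
        g (graph_param hdn f x) = p &
        range ('d (g \o graph_param hdn f) x) w]].

Definition normal_space (R : realType) (d n : nat) (hdn : (d <= n)%N)
    (M : set 'rV[R]_n) (p : 'rV[R]_n) : set 'rV[R]_n :=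
  [set u | forall w, tangent_space hdn M p w -> edot u w = 0].

Definition normal_bundle (R : realType) (d n : nat) (hdn : (d <= n)%N)
    (M : set 'rV[R]_n) : set ('rV[R]_n * 'rV[R]_n) :=
  [set pu | M pu.1 /\ normal_space hdn M pu.1 pu.2].

Definition codiagonal (R : realType) (n : nat)
    (xy : 'rV[R]_n * 'rV[R]_n) : 'rV[R]_n := xy.1 + xy.2.

(* Main.v *)
Require Import Defs.
From mathcomp Require Import all_boot all_order all_algebra.
From mathcomp Require Import all_classical all_reals all_analysis.
From mathcomp Require Import ring lra.
Import Order.TTheory GRing.Theory Num.Theory.
Import numFieldNormedType.Exports.
Local Open Scope classical_set_scope.
Local Open Scope ring_scope.

Set Implicit Arguments.
Unset Strict Implicit.
Unset Printing Implicit Defensive.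

(** Near a point [p] of [M], the set [M] is parametrized by
    [h x = g (x, f x)].  For [y] close to [p], a closest point of [M] to [y]
    exists and is a foot of a perpendicular from [y], so that [y] is the sum of
    a point of [M] and a normal vector there.  Hence every point of [M] is
    interior to the image of the normal bundle, and [nu] can be taken to be the
    interior of that image.

    Existence: minimize [|y - h x|^2] over a closed ball [K] of radius [r]
    around the parameter [x0] of [p]; [K] is compact and [f], being
    differentiable, is continuous.  If [|y - p| < r / 2], a minimizer [x1]
    satisfies [|h x1 - p| <= |h x1 - y| + |y - p| < r], and the inverse of the
    parametrization, an orthogonal projection, does not increase distances, so
    [x1] lies in the open ball.  Continuity of that projection then turns the
    minimum over [K] into a minimum over all points of [M] near [h x1]
    ([codiagonal_nbhs]).

    Perpendicularity: being closest among nearby points of [M] does not refer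
    to a parametrization, so it can be read in any graph representation of [M]
    through [h x1], where it says that a differentiable real function has a
    local minimum and hence a vanishing derivative ([nearest_point_normal]). *)

(** * The Euclidean product *)

Lemma edotE (R : realType) n (u v : 'rV[R]_n) : edot u v = (u *m v^T) 0 0.
Proof. by rewrite /edot mxE; apply: eq_bigr => i _; rewrite mxE. Qed.

Lemma edot0 (R : realType) n : edot (0 : 'rV[R]_n) 0 = 0.
Proof. by rewrite edotE mul0mx mxE. Qed.

Lemma edot_distC (R : realType) n (u v : 'rV[R]_n) :
  edot (u - v) (u - v) = edot (v - u) (v - u).
Proof. by rewrite -opprB !edotE linearN/= mulNmx mulmxN opprK. Qed.

Lemma edot_ge0 (R : realType) n (u : 'rV[R]_n) : 0 <= edot u u.
Proof. by apply: sumr_ge0 => i _; rewrite -expr2 sqr_ge0. Qed.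

Lemma edotB_le (R : realType) n (u v : 'rV[R]_n) :
  edot (u - v) (u - v) <= 2 * edot u u + 2 * edot v v.
Proof.
rewrite /edot !mulr_sumr -big_split/=; apply: ler_sum => i _; rewrite !mxE.
by have := sqr_ge0 (u 0 i + v 0 i); nra.
Qed.

(** Each coordinate is bounded by the Euclidean norm, which passes from
    Euclidean estimates to balls of the sup norm. *)
Lemma norm_lt_edot (R : realType) n (u : 'rV[R]_n) (r : R) :
  0 < r -> edot u u < r ^+ 2 -> `|u| < r.
Proof.
move=> r0; rewrite !ltNge; apply: contra.
rewrite [leRHS]/Num.Def.normr/= mx_normrE => /bigmax_geP[|[[i j] _ /=]].
  by rewrite leNgt r0.
rewrite (ord1 i) => ru; rewrite /edot (bigD1 j)//=.
have -> : u 0 j * u 0 j = `|u 0 j| ^+ 2 by rewrite real_normK ?num_real// expr2.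
rewrite -[leLHS]addr0 lerD//.
  by rewrite ler_sqr// nnegrE ltW.
by apply: sumr_ge0 => k _; rewrite -expr2 sqr_ge0.
Qed.

(** Bessel's inequality: the rows of [A] are orthonormal, so [z *m A^T] lists the
    coordinates of the orthogonal projection of [z] onto their span. *)
Lemma edot_mulmx_le (R : realType) d n (A : 'M[R]_(d, n)) (z : 'rV[R]_n) :
  A *m A^T = 1%:M -> edot (z *m A^T) (z *m A^T) <= edot z z.
Proof.
move=> AA.
(* [w] is the component of [z] orthogonal to the rows of [A]. *)
set w := z - z *m A^T *m A.
have wA : w *m A^T = 0 by rewrite mulmxBl -!mulmxA AA mulmx1 subrr.
rewrite -subr_ge0; suff -> : edot z z - edot (z *m A^T) (z *m A^T) = edot w w.
  exact: edot_ge0.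
have : w *m w^T = w *m z^T.
  by rewrite {2}/w linearB/= trmx_mul mulmxBr mulmxA wA mul0mx subr0.
rewrite !edotE => ->; rewrite trmx_mul trmxK /w mulmxBl !mulmxA.
by rewrite [RHS]mxE [X in _ = _ + X]mxE.
Qed.

(** * Differentiability of maps into row vectors *)

Lemma continuous_of_coord (R : realType) (T : topologicalType) n
    (g : T -> 'rV[R]_n) (t : T) :
  (forall i, {for t, continuous (fun s => g s 0 i)}) -> {for t, continuous g}.
Proof.
move=> cg; apply/cvgrPdist_lt => e e0; near=> s.
rewrite [ltLHS]/Num.Def.normr/= mx_normrE; apply/bigmax_ltP; split => // -[i j] _ /=.
rewrite (ord1 i) !mxE.
move: j; near: s; apply: filter_forall => j.
by move/cvgrPdist_lt : (cg j) => /(_ e e0).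
Unshelve. all: by end_near. Qed.

Lemma differentiable_comp_coord (R : realType) (V : normedModType R) n
    (g : V -> 'rV[R]_n) (x : V) i :
  differentiable g x -> differentiable (fun z => g z 0 i) x.
Proof.
move=> dg; apply: (@differentiable_comp _ _ _ _ g (fun u : 'rV_n => u 0 i)) => //.
exact: differentiable_coord.
Qed.

Lemma differentiable_mulmxr (R : realType) m n (A : 'M[R]_(m, n)) (x : 'rV[R]_m) :
  differentiable (mulmxr A : 'rV_m -> 'rV_n) x.
Proof.
apply: linear_differentiable => {}x; apply: continuous_of_coord => i.
rewrite (_ : (fun s => _) = \sum_j (fun s : 'rV[R]_m => s 0 j * A j i)).
  apply: differentiable_continuous; apply: differentiable_sum => j.
  apply: differentiableM => //; exact: differentiable_coord.
by apply/funext => s; rewrite /= mxE fct_sumE.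
Qed.

(** * Minima of the squared distance *)

Lemma sqdistE (R : realType) (V : Type) n (g : V -> 'rV[R]_n) (y : 'rV[R]_n) :
  (fun z => edot (y - g z) (y - g z)) =
  \sum_(i < n) (cst (y 0 i) - (fun z => g z 0 i)) ^+ 2.
Proof.
apply/funext => z; rewrite /edot fct_sumE; apply: eq_bigr => i _.
by rewrite !mxE -expr2.
Qed.

Lemma differentiable_sqdist (R : realType) (V : normedModType R) n
    (g : V -> 'rV[R]_n) (y : 'rV[R]_n) (x : V) : differentiable g x ->
  differentiable (fun z => edot (y - g z) (y - g z)) x.
Proof.
move=> dg; rewrite sqdistE; apply: differentiable_sum => i.
apply: differentiableX; apply: differentiableB => //.
exact: differentiable_comp_coord.
Qed.

Lemma derive_sqdist (R : realType) (V : normedModType R) n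
    (g : V -> 'rV[R]_n) (y : 'rV[R]_n) (x v : V) : differentiable g x ->
  'D_v (fun z => edot (y - g z) (y - g z)) x = - 2 * edot (y - g x) ('d g x v).
Proof.
move=> dg; rewrite sqdistE derive_sum; last first.
  move=> i; apply: diff_derivable; apply: differentiableX.
  by apply: differentiableB => //; exact: differentiable_comp_coord.
rewrite /edot mulr_sumr; apply: eq_bigr => i _.
have dgi : derivable (fun z => g z 0 i) x v.
  by apply: diff_derivable; exact: differentiable_comp_coord.
rewrite -deriveE// (derive_mx (diff_derivable dg)) !mxE.
rewrite deriveX//; last exact: derivableB.
rewrite deriveB// derive_cst sub0r /=.
rewrite !fctE /GRing.scale/= expr1; ring.
Qed.

(** Restricting [F] to the line through [x] directed by [v] reduces this to the
    one-variable criterion. *)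
Lemma minimum_derive_eq0 (R : realType) (V : normedModType R) (F : V -> R)
    (x v : V) :
  (\forall z \near x, differentiable F z) ->
  (\forall z \near x, F x <= F z) -> 'D_v F x = 0.
Proof.
move=> dF minF.
have cv : {for 0, continuous (fun t : R => t *: v + x)}.
  apply: differentiable_continuous; apply: differentiableD => //.
have cx : (fun t : R => t *: v + x) @ 0 --> x.
  by rewrite -[X in _ --> X]add0r -(scale0r v); exact: cv.
have /nbhs_ballP[e /= e0 he] : \forall t \near (0 : R),
    differentiable F (t *: v + x) /\ F x <= F (t *: v + x).
  by near=> t; split; near: t; [exact: cx dF|exact: cx minF].
have inb t : t \in `](- e), e[%R -> ball 0 e t.
  by rewrite in_itv/= /ball/= sub0r normrN ltr_norml.
pose phi (t : R) := F (t *: v + x).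
have : is_derive (0 : R) 1 phi 0.
  apply: (@derive1_at_min _ _ (- e) e).
  - by rewrite ge0_cp// ltW.
  - move=> t /inb/he[dFt _]; apply: diff_derivable.
    by apply: (@differentiable_comp _ _ _ _ (fun t : R => t *: v + x) F).
  - by rewrite in_itv/= oppr_lt0 e0.
  - by move=> t /inb/he[_]; rewrite /phi scale0r add0r.
move=> dphi.
rewrite -[RHS](@derive_val _ _ _ _ _ _ _ dphi) /phi /derive.
set a := (fun h : R => h^-1 *: _); set b := (fun h : R => h^-1 *: _).
suff -> : a = b by [].
by apply/funext => h; rewrite /a /b /= addr0 scale0r add0r [h%:A]mulr1.
Unshelve. all: by end_near. Qed.

(** The derivative of the squared distance along [v] is [-2] times the left-hand
    side. *)
Lemma closest_point_orthogonal (R : realType) (V : normedModType R) n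
    (g : V -> 'rV[R]_n) (y : 'rV[R]_n) (x v : V) :
  (\forall z \near x, differentiable g z) ->
  (\forall z \near x,
     edot (y - g x) (y - g x) <= edot (y - g z) (y - g z)) ->
  edot (y - g x) ('d g x v) = 0.
Proof.
move=> dg ming.
have := @minimum_derive_eq0 _ _ (fun z => edot (y - g z) (y - g z)) x v _ ming.
rewrite derive_sqdist; last exact: nbhs_singleton dg.
have /[swap]/[apply]/eqP : \forall z \near x,
    differentiable (fun z => edot (y - g z) (y - g z)) z.
  by apply: filterS dg => z; exact: differentiable_sqdist.
by rewrite mulf_eq0 oppr_eq0 pnatr_eq0/= => /eqP.
Qed.

(** * Graphs moved by rigid motions *)

(** The rows of [A] and [B] are the images, under the linear part of the rigid
    motion, of the first [d] and the last [n - d] standard basis vectors.  This form avoids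
    casts in all later arguments. *)
Lemma rigid_graphE (R : realType) (d n : nat) (hdn : (d <= n)%N)
    (g : 'rV[R]_n -> 'rV[R]_n) (f : 'rV[R]_d -> 'rV[R]_(n - d)) :
  rigid_motion g ->
  exists (A : 'M[R]_(d, n)) (B : 'M[R]_(n - d, n)) (a : 'rV[R]_n),
    [/\ A *m A^T = 1%:M, B *m A^T = 0 &
        g \o graph_param hdn f = fun x => x *m A + f x *m B + a].
Proof.
move=> [Q [a [QQ gE]]].
have [A [B [AA BA pE]]] : exists (A : 'M[R]_(d, n)) (B : 'M[R]_(n - d, n)),
    [/\ A *m A^T = 1%:M, B *m A^T = 0 &
        forall x, graph_param hdn f x = x *m A + f x *m B].
  (* Generalizing [n - d] makes the cast eliminable. *)
  rewrite /graph_param; move: (subnKC hdn).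
  move: (n - d)%N f {g gE Q a QQ} => e f en; case: n / en {hdn}.
  exists (row_mx 1%:M 0), (row_mx 0 1%:M); split => [||x].
  - by rewrite tr_row_mx mul_row_col trmx1 trmx0 mulmx1 mulmx0 addr0.
  - by rewrite tr_row_mx mul_row_col trmx1 trmx0 mul0mx mulmx0 addr0.
  - by rewrite castmx_id !mul_mx_row !mulmx1 !mulmx0 add_row_mx addr0 add0r.
exists (A *m Q), (B *m Q), a; split.
- by rewrite trmx_mul mulmxA -(mulmxA A) QQ mulmx1.
- by rewrite trmx_mul mulmxA -(mulmxA B) QQ mulmx1.
- by apply/funext => x; rewrite /= gE pE mulmxDl !mulmxA.
Qed.

(** The parameter is recovered from the point by orthogonal projection onto the
    rotated copy of [R^d]: the parametrization has a continuous, distance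
    nonincreasing inverse. *)
Lemma rigid_graph_projK (R : realType) (d n : nat) (hdn : (d <= n)%N)
    (g : 'rV[R]_n -> 'rV[R]_n) (f : 'rV[R]_d -> 'rV[R]_(n - d)) :
  rigid_motion g ->
  exists2 A : 'M[R]_(d, n), A *m A^T = 1%:M & forall x x',
    (g (graph_param hdn f x) - g (graph_param hdn f x')) *m A^T = x - x'.
Proof.
move=> /(@rigid_graphE _ _ _ hdn _ f)[A [B [a [AA BA E]]]].
exists A => // x x'.
have E' z : g (graph_param hdn f z) = z *m A + f z *m B + a.
  exact: (congr1 (@^~ z) E).
rewrite !E' opprD addrACA subrr addr0 opprD addrACA -!mulmxBl mulmxDl.
by rewrite -!mulmxA AA BA mulmx1 mulmx0 addr0.
Qed.

Lemma differentiable_rigid_graph (R : realType) (d n : nat) (hdn : (d <= n)%N)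
    (g : 'rV[R]_n -> 'rV[R]_n) (f : 'rV[R]_d -> 'rV[R]_(n - d)) x :
  rigid_motion g -> differentiable f x ->
  differentiable (g \o graph_param hdn f) x.
Proof.
move=> /(@rigid_graphE _ _ _ hdn _ f)[A [B [a [_ _ ->]]]] df.
apply: differentiableD => //; apply: differentiableD.
  exact: differentiable_mulmxr.
apply: (@differentiable_comp _ _ _ _ f (mulmxr B)) => //.
exact: differentiable_mulmxr.
Qed.

(** * Nearest points on a submanifold *)

(** The tangent space collects the differentials of all graph representations at
    [q].  The hypothesis does not mention a representation, so it applies to each
    of them. *)
Lemma nearest_point_normal (R : realType) (d n : nat) (hdn : (d <= n)%N)
    (M : set 'rV[R]_n) (q y : 'rV[R]_n) :
  (\forall z \near q, M z -> edot (y - q) (y - q) <= edot (y - z) (y - z)) ->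
  Defs.normal_space hdn M q (y - q).
Proof.
move=> minq _ [g [U [f [x [[rg oU df [V _ MV]] Ux xq [v _ <-]]]]]].
have nU : \forall z \near x, U z by exact: open_nbhs_nbhs.
have dgf z : U z -> differentiable (g \o graph_param hdn f) z.
  by move=> /df; exact: differentiable_rigid_graph.
subst q; apply: (@closest_point_orthogonal _ _ _ (g \o graph_param hdn f)).
  by apply: filterS nU.
have := differentiable_continuous (dgf _ Ux); move=> /(_ _ minq) nq; apply: filterS2 nU nq => z Uz /=; apply.
by have : (M `&` V) (g (graph_param hdn f z)); [rewrite MV; exists z|case].
Qed.

(** Every [y] in a Euclidean ball around [p] is reached from its nearest point on
    a compact piece of the graph around [p]. *)
Lemma codiagonal_nbhs (R : realType) (d n : nat) (hdn : (d <= n)%N)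
    (M : set 'rV[R]_n) (p : 'rV[R]_n) g U f :
  M p -> @local_graph R d n hdn M p g U f ->
  nbhs p (@codiagonal R n @` normal_bundle hdn M).
Proof.
move=> Mp [rg oU df [V [oV Vp] MV]].
pose h x := g (graph_param hdn f x).
have [x0 Ux0 hx0] : [set h x | x in U] p by rewrite -MV.
have MVh x : U x -> (M `&` V) (h x) by move=> Ux; rewrite MV; exists x.
have [A AA hA] : exists2 A : 'M[R]_(d, n), A *m A^T = 1%:M &
    forall x x', (h x - h x') *m A^T = x - x'.
  exact: rigid_graph_projK.
have dh x : U x -> differentiable h x.
  by move=> /df; exact: differentiable_rigid_graph.
have /nbhs_closedballP[r xrU] : nbhs x0 U by exact: open_nbhs_nbhs.
set K := closed_ball x0 r%:num in xrU.
have cK : compact K.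
  apply: bounded_closed_compact; last exact: closed_ball_closed.
  exists (`|x0| + r%:num); split; first exact: num_real.
  move=> e /ltW xe x; rewrite /K closed_ballE// /closed_ball_/= => xx.
  apply: le_trans xe; rewrite -[x](subrK x0) addrC.
  by rewrite (le_trans (ler_normD _ _))// lerD// distrC.
(* Half of [r] : the distances from [y] to [p] and to its nearest point must add
   up to less than [r]. *)
have nearp : \forall y \near p, edot (y - p) (y - p) < (r%:num / 2) ^+ 2.
  have c : {for p, continuous (fun y : 'rV[R]_n => edot (p - y) (p - y))}.
    apply: differentiable_continuous.
    by apply: (@differentiable_sqdist _ _ _ id).
  near=> y; rewrite edot_distC; near: y.
  move/cvgrPdist_lt : c => /(_ ((r%:num / 2) ^+ 2)).
  rewrite subrr edot0 exprn_gt0// => /(_ isT); apply: filterS => z /=.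
  by rewrite sub0r normrN ger0_norm// edot_ge0.
apply: filterS nearp => y yp.
have [||x1] := @compact_EVT_min _ _ (fun x => edot (y - h x) (y - h x)) K _ cK.
- by exists x0; exact: closed_ballxx.
- apply: continuous_in_subspaceT => x /set_mem /xrU Ux.
  by apply: differentiable_continuous; apply: differentiable_sqdist; exact: dh.
move=> /set_mem Kx1 minx1.
have x0K : x0 \in K by apply/mem_set; exact: closed_ballxx.
(* The minimizer is an interior point of [K]. *)
have x1r : ball x0 r%:num x1.
  rewrite -ball_normE/= -hA hx0; apply: norm_lt_edot => //.
  apply: le_lt_trans (edot_mulmx_le _ AA) _.
  have := minx1 _ x0K; rewrite hx0 => h1.
  have -> : p - h x1 = (y - h x1) - (y - p) by rewrite opprB [RHS]addrC subrKA.
  apply: le_lt_trans (edotB_le _ _) _; nra.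
have [Mq Vq] := MVh _ (xrU _ Kx1).
exists (h x1, y - h x1); last by rewrite /codiagonal/= addrC subrK.
split => //=; apply: nearest_point_normal.
(* The inverse of [h] : points of [M] near [h x1] have parameters in [K], hence
   compete in the minimization. *)
have cproj : {for h x1, continuous (fun z : 'rV[R]_n => (z - h x1) *m A^T + x1)}.
  apply: differentiable_continuous; apply: differentiableD => //.
  apply: (@differentiable_comp _ _ _ _ (fun z : 'rV[R]_n => z - h x1)
    (mulmxr A^T)) => //.
  exact: differentiable_mulmxr.
have nx1 : \forall z \near h x1, ball x0 r%:num ((z - h x1) *m A^T + x1).
  apply: cproj; rewrite subrr mul0mx add0r.
  by apply: open_nbhs_nbhs; split => //; exact: ball_open.
have nV : \forall z \near h x1, V z by exact: open_nbhs_nbhs.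
apply: filterS2 nV nx1 => z Vz zb Mz.
have [x Ux xz] : [set h x | x in U] z by rewrite -MV.
rewrite -xz; apply: minx1; apply/mem_set; apply: subset_closed_ball.
by move: zb; rewrite -xz hA subrK.
Unshelve. all: by end_near. Qed.

Theorem corollary2p1p4 (R : realType) (d n : nat) (hdn : (d <= n)%N)
    (M : set 'rV[R]_n) (hM : differentiable_submanifold hdn M) :
  (exists nu : set 'rV[R]_n,
    [/\ open nu, M `<=` nu &
        nu `<=` @codiagonal R n @` normal_bundle hdn M]) /\
  interior (@codiagonal R n @` normal_bundle hdn M) !=set0.
Proof.
have [[[p _] _ _ _ _] chart] := hM.
have Mint : M `<=` interior (@codiagonal R n @` normal_bundle hdn M).
  by move=> q Mq; have [g [U [f]]] := chart _ Mq; exact: codiagonal_nbhs.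
split; last by exists (\val p); apply: Mint; exact: set_valP.
exists (interior (@codiagonal R n @` normal_bundle hdn M)).
by split => //; [exact: open_interior|exact: interior_subset].
Qed.
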